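(* Let $\mathbf{k}$ be a field, $n\geq 2$, $A$ the free algebra on $n$ generators and $L$ the $n$th Leavitt algebra over $\mathbf{k}$. Let $\mathrm{Rep}_{\mathrm{full}}^{\mathrm{nd}}(A)$ be the full subcategory of $\mathrm{Rep}(A)$ of full and nondegenerate representations of $A$, and let $\mathrm{Rep}_{\mathcal S}(L)$ be the full subcategory of $\mathrm{Rep}(L)$ with class of objects $\{\Pi(V):\ V\in\mathcal S\}$. Let $\Pi_{\mathrm{full}}^{\mathrm{nd}}$ be the restriction of $\Pi$ to $\mathrm{Rep}_{\mathrm{full}}^{\mathrm{nd}}(A)$ and $\Lambda_{\mathcal S}$ the restriction of $\Lambda$ to $\mathrm{Rep}_{\mathcal S}(L)$. Then the functors $$\Pi_{\mathrm{full}}^{\mathrm{nd}}:\mathrm{Rep}_{\mathrm{full}}^{\mathrm{nd}}(A)\to \mathrm{Rep}_{\mathcal S}(L) \quad\text{and}\quad \Sigma\circ\Lambda_{\mathcal S}:\mathrm{Rep}_{\mathcal S}(L)\to \mathrm{Rep}_{\mathrm{full}}^{\mathrm{nd}}(A)$$ define an equivalence of categories (they are quasi-inverse to each other).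
   Context: **Algebras and modules.** $\mathbf{k}$ is a field, $n\ge 2$. $A$ is the free unital $\mathbf{k}$-algebra on $e_1,\dots,e_n$. $L$ is the Leavitt algebra: the unital $\mathbf{k}$-algebra generated by $e_1,\dots,e_n,e_1^*,\dots,e_n^*$ with relations $\sum_{i=1}^n e_ie_i^*=1$ and $e_j^*e_k=\delta_{j,k}$. Representations are right modules, written $v\cdot b$, assumed unital; $\mathrm{Rep}(A)$, $\mathrm{Rep}(L)$ are the categories of unital right modules (of arbitrary dimension). $\Lambda:\mathrm{Rep}(L)\to\mathrm{Rep}(A)$ is restriction along the algebra morphism $\iota:A\to L$, $e_i\mapsto e_i$. A path (or word) $p$ is a finite product of the $e_i$; its length is $|p|$. **Trees.** A tree is a finite rooted planar tree in which each vertex has either $n$ ordered children or none (leaves). $I$ is the trivial tree with one vertex, $\wedge$ the caret (root with $n$ leaves). $\mathcal T$ is the set of trees. Each leaf $\ell$ of a tree is identified with the word in the $e_i$'s describing the path from the root to $\ell$ ($e_i$ = go to the $i$th child). For $V\in\mathrm{Rep}(A)$ and a tree $t$ let $\Phi(t):V\to V^{\mathrm{Leaf}(t)}$, $v\mapsto (v\cdot \ell)_{\ell\in\mathrm{Leaf}(t)}$. **The functor $\Pi:\mathrm{Rep}(A)\to\mathrm{Rep}(L)$.** $\Pi(V)$ is the set of classes $[t,v]$ of pairs $(t,v)$ with $t\in\mathcal T$, $v:\mathrm{Leaf}(t)\to V$, for the equivalence relation generated by: $(t,v)\sim(t',v')$ whenever $t'$ is obtained from $t$ by gluing a tree $s_\ell$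 at each leaf $\ell$ of $t$, and $v'$ is obtained by decorating the leaves of $s_\ell$ with $\Phi(s_\ell)(v_\ell)$. Equivalently, $\Pi(V)$ is the vector space direct limit of the spaces $V^{\mathrm{Leaf}(t)}$. The $L$-action: if $t$ is the caret with trees $t_1,\dots,t_n$ glued at its leaves and $v_j$ is the restriction of $v$ to the leaves of $t_j$, then $[t,v]\cdot e_j=[t_j,v_j]$; and $[s,w]\cdot e_j^*$ is the class of the caret with $(s,w)$ glued at its $j$th leaf and its other leaves decorated by $0$. On morphisms, $\Pi(\theta)[t,v_1,\dots,v_k]=[t,\theta(v_1),\dots,\theta(v_k)]$. The canonical map is $j_V:V\to\Pi(V)$, $v\mapsto[I,v]$, a morphism of $A$-modules $V\to\Lambda(\Pi(V))$. **Completeness, class $\mathcal S$, fullness, nondegeneracy.** A submodule $V_c\subset V$ is complete if for every $v\in V$ there is $k\geq1$ with $v\cdot p\in V_c$ for all paths $p$ with $|p|\ge k$. $\mathcal S$ is the class of $V\in\mathrm{Rep}(A)$ admitting a smallest (for inclusion) complete submodule, denoted $V_s$. $V$ is full if it has no proper complete submodule. $V$ is nondegenerate if $j_V$ is injective. $\Sigma$ is the functor defined on the full subcategory $\mathrm{Rep}_{\mathcal S}(A)$ of $\mathrm{Rep}(A)$ with objects in $\mathcal S$, by $\Sigma(V)=V_s$ and $\Sigma(\theta)=\theta|_{V_s}:V_s\to V'_s$ for $\theta:V\to V'$. *)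

(* Defs.v *)
From HB Require Import structures.
From Stdlib Require Import Relations.
From mathcomp Require Import all_boot all_order all_algebra.
From mathcomp Require Import generic_quotient ring_quotient.
From mathcomp Require Import finmap monalg.
From mathcomp Require Import boolp.

Set Implicit Arguments.
Unset Strict Implicit.
Unset Printing Implicit Defensive.

Import GRing.Theory.
Local Open Scope ring_scope.
Local Open Scope quotient_scope.

Record category := Category {
  obj :> Type;
  hom : obj -> obj -> Type;
  idm : forall X, hom X X;
  comp : forall X Y Z, hom Y Z -> hom X Y -> hom X Z;
  comp_idl : forall X Y (f : hom X Y), comp (idm Y) f = f;
  comp_idr : forall X Y (f : hom X Y), comp f (idm X) = f;
  compA : forall X Y Z T (h : hom Z T) (g : hom Y Z) (f : hom X Y),
    comp h (comp g f) = comp (comp h g) f }.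

Record functor (C D : category) := Functor {
  fobj :> C -> D;
  fmor : forall X Y, hom X Y -> hom (fobj X) (fobj Y);
  fmor_id : forall X, fmor (idm X) = idm (fobj X);
  fmor_comp : forall X Y Z (g : hom Y Z) (f : hom X Y),
    fmor (comp g f) = comp (fmor g) (fmor f) }.

Definition id_functor (C : category) : functor C C :=
  @Functor C C (fun X => X) (fun X Y f => f)
    (fun X => erefl) (fun X Y Z g f => erefl).

Section CompFunctor.
Variables (C D E : category) (G : functor D E) (F : functor C D).

Lemma comp_functor_id X : fmor G (fmor F (idm X)) = idm (G (F X)).
Proof. by rewrite !fmor_id. Qed.

Lemma comp_functor_comp X Y Z (g : hom Y Z) (f : hom X Y) :
  fmor G (fmor F (comp g f)) = comp (fmor G (fmor F g)) (fmor G (fmor F f)).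
Proof. by rewrite !fmor_comp. Qed.

Definition comp_functor : functor C E :=
  @Functor C E (fun X => G (F X)) (fun X Y f => fmor G (fmor F f))
    comp_functor_id comp_functor_comp.
End CompFunctor.

Definition full_subcategory (C : category) (P : C -> Prop) : category :=
  @Category {X : C | P X} (fun X Y => hom (sval X) (sval Y))
    (fun X => idm (sval X)) (fun X Y Z g f => comp g f)
    (fun X Y f => comp_idl f) (fun X Y f => comp_idr f)
    (fun X Y Z T h g f => compA h g f).

Definition incl (C : category) (P : C -> Prop) :
    functor (full_subcategory P) C :=
  @Functor (full_subcategory P) C (fun X => sval X) (fun X Y f => f)
    (fun X => erefl) (fun X Y Z g f => erefl).

Definition restrict (C D : category) (P : C -> Prop) (F : functor C D) :
    functor (full_subcategory P) D := comp_functor F (incl P).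

Definition corestrict (C D : category) (P : D -> Prop) (F : functor C D)
    (FP : forall X, P (F X)) : functor C (full_subcategory P) :=
  @Functor C (full_subcategory P) (fun X => exist P (F X) (FP X))
    (fun X Y f => fmor F f) (fmor_id F) (fun X Y Z g f => fmor_comp F g f).

Definition is_iso (C : category) (X Y : C) (f : hom X Y) : Prop :=
  exists g : hom Y X, comp g f = idm X /\ comp f g = idm Y.

Definition naturally_isomorphic (C D : category) (F G : functor C D) : Prop :=
  exists eta : forall X, hom (F X) (G X),
    (forall X Y (f : hom X Y),
       comp (eta Y) (fmor F f) = comp (fmor G f) (eta X)) /\
    (forall X, is_iso (eta X)).

Definition quasi_inverse (C D : category) (F : functor C D) (G : functor D C) :
    Prop :=
  naturally_isomorphic (comp_functor G F) (id_functor C) /\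
  naturally_isomorphic (comp_functor F G) (id_functor D).

(* A right module over R is a left module over the converse ring R^c. *)
Definition ract (R : pzRingType) (V : lmodType R^c) (v : V) (a : R) : V :=
  (a : R^c) *: v.

Lemma ract1 (R : pzRingType) (V : lmodType R^c) (v : V) : ract v 1 = v.
Proof. exact: scale1r. Qed.

Lemma ractM (R : pzRingType) (V : lmodType R^c) (v : V) (a b : R) :
  ract v (a * b) = ract (ract v a) b.
Proof. by rewrite /ract scalerA. Qed.

Lemma linear_ext (R : pzRingType) (U V : lmodType R) (f g : {linear U -> V}) :
  f =1 g -> f = g.
Proof.
move=> /funext; case: f g => [f cf] [g cg] /= efg.
case: _ / efg in cg *; congr GRing.Linear.Pack.
case: cf cg => [[a1] [a2]] [[b1] [b2]].
by rewrite (Prop_irrelevance a1 b1) (Prop_irrelevance a2 b2).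
Qed.

Section Rep.
Variable R : pzRingType.

Definition Rep_hom (U V : lmodType R^c) : Type := {linear U -> V}.
Definition Rep_id (U : lmodType R^c) : Rep_hom U U := idfun : {linear U -> U}.
Definition Rep_comp (U V W : lmodType R^c) (g : Rep_hom V W)
  (f : Rep_hom U V) : Rep_hom U W := (g \o f : {linear U -> W}).

(* All right R-modules; for R = A or L the k-vector space structure of a module
   is the one given by the scalars in R. *)
Definition Rep : category.
Proof.
refine (@Category (lmodType R^c) Rep_hom Rep_id Rep_comp _ _ _);
  by move=> *; apply: linear_ext.
Defined.
End Rep.

Section Restriction.
Variables (R S : pzRingType) (f : {rmorphism R -> S}).

Definition restr (W : lmodType S^c) : Type := W.

Section Object.
Variable W : lmodType S^c.

Definition restr_scale (a : R^c) (w : W) : W := ract w (f a).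

HB.instance Definition _ := GRing.Zmodule.on (restr W).

Fact restr_scalerA (a b : R^c) (w : restr W) :
  restr_scale a (restr_scale b w) = restr_scale (a * b) w.
Proof. by rewrite /restr_scale -ractM -rmorphM. Qed.

Fact restr_scale1r : left_id 1 (restr_scale : R^c -> restr W -> restr W).
Proof. by move=> w; rewrite /restr_scale rmorph1 ract1. Qed.

Fact restr_scalerDr :
  right_distributive (restr_scale : R^c -> restr W -> restr W) +%R.
Proof. by move=> a w w'; apply: scalerDr. Qed.

Fact restr_scalerDl (w : restr W) :
  {morph (restr_scale^~ w : R^c -> restr W) : a b / a + b}.
Proof. by move=> a b; rewrite /restr_scale /ract rmorphD; apply: scalerDl. Qed.

HB.instance Definition _ := GRing.Zmodule_isLmodule.Build R^c (restr W)
  restr_scalerA restr_scale1r restr_scalerDr restr_scalerDl.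
End Object.

Section Morphism.
Variables (W W' : lmodType S^c) (g : {linear W -> W'}).

Definition restr_fun (w : restr W) : restr W' := g w.

Fact restr_fun_is_linear : linear restr_fun.
Proof. by move=> a u v; apply: (linearP g (f a : S^c)). Qed.

HB.instance Definition _ := GRing.isLinear.Build R^c (restr W) (restr W') _
  restr_fun restr_fun_is_linear.
End Morphism.

Definition Restr : functor (Rep S) (Rep R).
Proof.
refine (@Functor (Rep S) (Rep R) (fun W => restr W : lmodType R^c)
  (fun W W' g => restr_fun g : {linear restr W -> restr W'}) _ _);
  by move=> *; apply: linear_ext.
Defined.
End Restriction.

Section Submodule.
Variables (R : pzRingType) (V : lmodType R) (S : submodClosed V).

Inductive submod : predArgType := Submod v of v \in S.
Definition submod_val (u : submod) : V := let: Submod v _ := u in v.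
HB.instance Definition _ := [isSub for submod_val].
HB.instance Definition _ := [Choice of submod by <:].
HB.instance Definition _ := [SubChoice_isSubLmodule of submod by <:].
End Submodule.

Section GeneratedIdeal.
Variables (R : pzRingType) (P : R -> Prop).

Inductive two_sided_ideal : R -> Prop :=
| Ideal_gen x of P x : two_sided_ideal x
| Ideal_0 : two_sided_ideal 0
| Ideal_D x y of two_sided_ideal x & two_sided_ideal y :
    two_sided_ideal (x + y)
| Ideal_Ml a x of two_sided_ideal x : two_sided_ideal (a * x)
| Ideal_Mr a x of two_sided_ideal x : two_sided_ideal (x * a).

Definition ideal_pred : {pred R} := fun x => `[< two_sided_ideal x >].

Fact ideal_zmod_closed : zmod_closed ideal_pred.
Proof.
split=> [|x y /asboolP Ix /asboolP Iy]; apply/asboolP; first exact: Ideal_0.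
by rewrite -mulN1r; apply: Ideal_D => //; apply: Ideal_Ml.
Qed.

HB.instance Definition _ := GRing.isZmodClosed.Build R ideal_pred
  ideal_zmod_closed.
End GeneratedIdeal.

Section QuotientRing.
Variables (R : pzRingType) (P : R -> Prop).

(* The library only puts a ring structure on quotients of commutative rings;
   the additive quotient is the library's. *)
Definition quot_ring : Type := Quotient.quot (ideal_pred P).
HB.instance Definition _ := GRing.Zmodule.on quot_ring.

Definition to_quot (x : R) : quot_ring := \pi_(Quotient.quot (ideal_pred P)) x.
Definition of_quot (q : quot_ring) : R :=
  repr (q : Quotient.quot (ideal_pred P)).

Lemma of_quotK : cancel of_quot to_quot. Proof. exact: reprK. Qed.

Lemma to_quot_eq x y : to_quot x = to_quot y <-> two_sided_ideal P (x - y).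
Proof.
split=> [/eqP|H]; first by rewrite -Quotient.idealrBE => /asboolP.
by apply/eqP; rewrite -Quotient.idealrBE; apply/asboolP.
Qed.

Lemma to_quotD : {morph to_quot : x y / x + y}.
Proof. exact: (raddfD \pi_(Quotient.quot (ideal_pred P))). Qed.

Definition quot_one : quot_ring := to_quot 1.
Definition quot_mul (p q : quot_ring) : quot_ring :=
  to_quot (of_quot p * of_quot q).

Lemma to_quotM x y : to_quot (x * y) = quot_mul (to_quot x) (to_quot y).
Proof.
apply/to_quot_eq.
have Ix z : two_sided_ideal P (z - of_quot (to_quot z)).
  by apply/to_quot_eq; rewrite of_quotK.
rewrite -[x * y](addrNK (of_quot (to_quot x) * y)) -mulrBl -addrA -mulrBr.
by apply: Ideal_D; [apply: Ideal_Mr | apply: Ideal_Ml]; apply: Ix.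
Qed.

Fact quot_mulA : associative quot_mul.
Proof.
move=> x y z; rewrite -[x]of_quotK -[y]of_quotK -[z]of_quotK.
by rewrite -!to_quotM mulrA.
Qed.
Fact quot_mul1r : left_id quot_one quot_mul.
Proof. by move=> x; rewrite -[x]of_quotK -to_quotM mul1r. Qed.
Fact quot_mulr1 : right_id quot_one quot_mul.
Proof. by move=> x; rewrite -[x]of_quotK -to_quotM mulr1. Qed.
Fact quot_mulDl : left_distributive quot_mul +%R.
Proof.
move=> x y z; rewrite -[x]of_quotK -[y]of_quotK -[z]of_quotK.
by rewrite -to_quotD -!to_quotM -to_quotD mulrDl.
Qed.
Fact quot_mulDr : right_distributive quot_mul +%R.
Proof.
move=> x y z; rewrite -[x]of_quotK -[y]of_quotK -[z]of_quotK.
by rewrite -to_quotD -!to_quotM -to_quotD mulrDr.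
Qed.

HB.instance Definition _ := GRing.Zmodule_isPzRing.Build quot_ring
  quot_mulA quot_mul1r quot_mulr1 quot_mulDl quot_mulDr.

Fact to_quot_is_zmod_morphism : zmod_morphism to_quot.
Proof. exact: (raddfB \pi_(Quotient.quot (ideal_pred P))). Qed.
Fact to_quot_is_monoid_morphism : monoid_morphism to_quot.
Proof. by split=> // x y; exact: to_quotM. Qed.
HB.instance Definition _ := GRing.isZmodMorphism.Build R quot_ring to_quot
  to_quot_is_zmod_morphism.
HB.instance Definition _ := GRing.isMonoidMorphism.Build R quot_ring to_quot
  to_quot_is_monoid_morphism.
End QuotientRing.

(* The free unital k-algebra on X: its basis {fmonom X} is the free monoid of
   words in X, << w >> is the basis element of w and c%:MP the scalar c. *)
Definition free_alg (k : fieldType) (X : choiceType) : nzRingType :=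
  {malg k[{fmonom X}]}.

Definition gen (k : fieldType) (X : choiceType) (x : X) : free_alg k X :=
  << fmu x >>.

Section Algebras.
Variables (k : fieldType) (n : nat).

Definition A : nzRingType := free_alg k 'I_n.

(* inl i is the generator e_i and inr i the generator e_i^*. *)
Definition LX : choiceType := ('I_n + 'I_n)%type.

Inductive leavitt_relation : free_alg k LX -> Prop :=
| Leavitt_sum :
    leavitt_relation ((\sum_(i < n) gen k (inl i : LX) * gen k (inr i : LX)) - 1)
| Leavitt_orth (i j : 'I_n) :
    leavitt_relation (gen k (inr i : LX) * gen k (inl j : LX) - (i == j)%:R).

Definition L : pzRingType := quot_ring leavitt_relation.

Definition iota_word (w : {fmonom 'I_n}) : free_alg k LX :=
  << FMonom [seq (inl i : LX) | i <- w] >>.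

Lemma free_algUM (X : choiceType) (v w : {fmonom X}) :
  << v >> * << w >> = << mmul v w >> :> free_alg k X.
Proof. by rewrite malgM_def fgmulUU mulr1. Qed.

Fact iota_word_is_mmorphism : mmorphism iota_word.
Proof.
split=> [v w|]; rewrite /iota_word; last first.
  by rewrite fm1; congr << _ >>; apply/val_inj; rewrite /= fm1.
rewrite free_algUM; congr << _ >>; apply/val_inj => /=.
by rewrite !fmM map_cat.
Qed.
HB.instance Definition _ := isMultiplicative.Build _ _ iota_word
  iota_word_is_mmorphism.

Definition iota_free : A -> free_alg k LX :=
  mmap (@malgC {fmonom LX} k) iota_word.

Fact iota_free_is_monoid_morphism : monoid_morphism iota_free.
Proof.
have := @commr_mmap_is_multiplicative {fmonom 'I_n} k (free_alg k LX)
  (@malgC {fmonom LX} k) iota_word.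
case=> [g m m'|iM i1]; last by split.
by rewrite /GRing.comm /iota_word !malgM_def !fgmulUU mulr1 mul1r mul1m mulm1.
Qed.
HB.instance Definition _ := GRing.isZmodMorphism.Build A (free_alg k LX)
  iota_free (mmap_is_additive (f := @malgC {fmonom LX} k) (h := iota_word)).
HB.instance Definition _ := GRing.isMonoidMorphism.Build A (free_alg k LX)
  iota_free iota_free_is_monoid_morphism.

Definition iota : {rmorphism A -> L} :=
  @to_quot _ leavitt_relation \o iota_free.

Lemma iota_gen i : iota (gen k i) = to_quot leavitt_relation (gen k (inl i : LX)).
Proof.
rewrite /iota /= /iota_free /gen mmapU /iota_word [X in X * _](_ : _ = 1) // mul1r;
  congr to_quot.
by congr << _ >>; apply/val_inj; rewrite /= !fmU.
Qed.

Lemma iota_const (c : k) : iota (c%:MP : A) = to_quot leavitt_relation c%:MP.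
Proof.
rewrite /iota /= /iota_free mmapU /iota_word; congr to_quot.
rewrite [X in _ * << X >>](_ : _ = mone); first by rewrite mulr1.
by apply/val_inj; rewrite /= !fm1.
Qed.
End Algebras.

(* A k-vector space with an operator for each generator in X is a right module
   over the free algebra on X, the word x_1 ... x_m acting by T x_1 first; it is
   one over a quotient of the free algebra if the relations act by 0. *)
Section Operators.
Variables (k : fieldType) (X : choiceType) (W : lmodType k).
Variable T : X -> {linear W -> W}.

Definition word_act (m : seq X) (w : W) : W := foldl (fun u x => T x u) w m.

Definition op_act (f : free_alg k X) (w : W) : W :=
  \sum_(m <- msupp f) f@_m *: word_act m w.

Lemma word_act_is_linear m : linear (word_act m).
Proof.
by elim: m => // x m IH a u v; rewrite /word_act /= linearP; apply: IH.
Qed.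
HB.instance Definition _ m := GRing.isLinear.Build k W W *:%R (word_act m)
  (word_act_is_linear m).

Lemma op_actEw (d : {fset {fmonom X}}) f w : (msupp f `<=` d)%fset ->
  op_act f w = \sum_(m <- d) f@_m *: word_act m w.
Proof.
move=> le; rewrite [LHS](big_fset_incl _ le) => //= x xd /mcoeff_outdom ->.
by rewrite scale0r.
Qed.

Lemma op_actU c m w : op_act << c *g m >> w = c *: word_act m w.
Proof. by rewrite (op_actEw _ msuppU_le) big_seq_fset1 mcoeffUU. Qed.

Lemma op_act_is_linear f : linear (op_act f).
Proof.
move=> a u v; rewrite /op_act scaler_sumr -big_split /=.
by apply: eq_bigr => m _; rewrite linearP scalerDr !scalerA mulrC.
Qed.
HB.instance Definition _ f := GRing.isLinear.Build k W W *:%R (op_act f)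
  (op_act_is_linear f).

Lemma op_actD f g w : op_act (f + g) w = op_act f w + op_act g w.
Proof.
pose d := (msupp f `|` msupp g `|` msupp (f + g))%fset.
rewrite !(op_actEw (d := d));
  try by apply/fsubsetP => x; rewrite !inE => ->; rewrite ?orbT.
by rewrite -big_split /=; apply: eq_bigr => m _; rewrite mcoeffD scalerDl.
Qed.

Lemma op_act0 w : op_act 0 w = 0.
Proof. by rewrite /op_act msupp0 big_seq_fset0. Qed.

Lemma op_act_sum (J : Type) (r : seq J) (F : J -> free_alg k X) w :
  op_act (\sum_(j <- r) F j) w = \sum_(j <- r) op_act (F j) w.
Proof.
by apply: (big_morph (op_act^~ w) (fun f g => op_actD f g w)); apply: op_act0.
Qed.

Lemma op_act1 w : op_act 1 w = w.
Proof. by rewrite [1]/(<< mone >>) op_actU scale1r fm1. Qed.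

Lemma op_actM f g w : op_act (f * g) w = op_act g (op_act f w).
Proof.
rewrite malgME op_act_sum [op_act f w]/op_act linear_sum; apply: eq_bigr => m _ /=.
rewrite op_act_sum linearZ /= [op_act g _]/op_act scaler_sumr.
by apply: eq_bigr => m' _; rewrite op_actU fmM /word_act foldl_cat scalerA.
Qed.

Lemma op_actN f w : op_act (- f) w = - op_act f w.
Proof. by apply/eqP; rewrite -addr_eq0 -op_actD addNr op_act0. Qed.

Lemma op_act_gen x w : op_act (gen k x) w = T x w.
Proof. by rewrite /gen op_actU scale1r fmU. Qed.

Variable P : free_alg k X -> Prop.
Definition satisfies := forall f, P f -> forall w, op_act f w = 0.

Hypothesis HP : satisfies.
(* W itself; HP is kept so that the module structure can be found from the
   type. *)
Definition op_module : Type := let _ := HP in W.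
HB.instance Definition _ := GRing.Zmodule.copy op_module W.

Definition op_scale (q : (quot_ring P)^c) (w : op_module) : op_module :=
  op_act (of_quot (q : quot_ring P)) w.

Lemma op_act_ideal f : two_sided_ideal P f -> forall w, op_act f w = 0.
Proof.
elim=> {f} [f /HP//||f g _ IHf _ IHg|a f _ IH|a f _ IH] w.
- exact: op_act0.
- by rewrite op_actD IHf IHg addr0.
- by rewrite op_actM IH.
- by rewrite op_actM IH linear0.
Qed.

Lemma op_act_quot f w : op_act (of_quot (to_quot P f)) w = op_act f w.
Proof.
apply/eqP; rewrite -subr_eq0 -op_actN -op_actD; apply/eqP/op_act_ideal.
by apply/to_quot_eq; rewrite of_quotK.
Qed.

Fact op_scalerA a b (w : op_module) :
  op_scale a (op_scale b w) = op_scale (a * b) w.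
Proof.
by rewrite /op_scale -op_actM -op_act_quot.
Qed.
Fact op_scale1r : left_id 1 op_scale.
Proof. by move=> w; rewrite /op_scale op_act_quot op_act1. Qed.
Fact op_scalerDr : right_distributive op_scale +%R.
Proof. by move=> a u v; apply: (linearD (op_act _)). Qed.
Fact op_scalerDl w : {morph op_scale^~ w : a b / a + b}.
Proof.
move=> a b; rewrite /op_scale -op_actD -[RHS]op_act_quot; congr op_act.
by rewrite to_quotD !of_quotK.
Qed.
HB.instance Definition _ := GRing.Zmodule_isLmodule.Build (quot_ring P)^c
  op_module op_scalerA op_scale1r op_scalerDr op_scalerDl.

Lemma op_module_ract (w : op_module) f :
  ract w (to_quot P f) = op_act f w.
Proof. by rewrite -op_act_quot. Qed.
End Operators.

Section OperatorMorphism.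
Variables (k : fieldType) (X : choiceType) (W W' : lmodType k).
Variables (T : X -> {linear W -> W}) (T' : X -> {linear W' -> W'}).
Variables (P : free_alg k X -> Prop) (HP : satisfies T P) (HP' : satisfies T' P).
Variables (g : {linear W -> W'}) (Hg : forall x w, g (T x w) = T' x (g w)).

Lemma op_act_morph f w : g (op_act T f w) = op_act T' f (g w).
Proof.
rewrite /op_act linear_sum; apply: eq_bigr => m _; rewrite linearZ /=.
congr (_ *: _); rewrite /word_act; elim: (m : seq X) w => //= x s IH w.
by rewrite IH Hg.
Qed.

Definition op_fun : op_module HP -> op_module HP' := let _ := Hg in g.

Fact op_fun_is_linear : linear op_fun.
Proof.
move=> a u v; rewrite /op_fun [LHS](raddfD g); congr (_ + _).
exact: op_act_morph.
Qed.
HB.instance Definition _ := GRing.isLinear.Build (quot_ring P)^c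
  (op_module HP) (op_module HP') _ op_fun op_fun_is_linear.
End OperatorMorphism.

Section Trees.
Variable n : nat.

(* Infinite depth is excluded by induction, infinite branching by 'I_n. *)
Inductive tree : Type := Triv | Node of ('I_n -> tree).

Fixpoint Leaf (t : tree) : Type :=
  match t with Triv => unit | Node f => {i : 'I_n & Leaf (f i)} end.

Fixpoint leaf_word (t : tree) : Leaf t -> {fmonom 'I_n} :=
  match t return Leaf t -> {fmonom 'I_n} with
  | Triv => fun _ => mone
  | Node f => fun l => mmul (fmu (tag l)) (leaf_word (tagged l))
  end.

Fixpoint glue (t : tree) : (Leaf t -> tree) -> tree :=
  match t return (Leaf t -> tree) -> tree with
  | Triv => fun s => s tt
  | Node f => fun s =>
      Node (fun i => glue (fun l => s (@Tagged _ i (fun i => Leaf (f i)) l)))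
  end.

(* A leaf of a glued tree is a leaf l of t followed by a leaf of s l. *)
Fixpoint leaf_glue (t : tree) :
    forall s : Leaf t -> tree, Leaf (glue s) -> {l : Leaf t & Leaf (s l)} :=
  match t return forall s : Leaf t -> tree,
      Leaf (glue s) -> {l : Leaf t & Leaf (s l)} with
  | Triv => fun s m => existT (fun l => Leaf (s l)) tt m
  | Node f => fun s m =>
      let i := tag m in
      let lm := leaf_glue (tagged m) in
      existT (fun l => Leaf (s l))
        (@Tagged _ i (fun i => Leaf (f i)) (tag lm)) (tagged lm)
  end.

Lemma leaf_word_glue (t : tree) (s : Leaf t -> tree) (m : Leaf (glue s)) :
  leaf_word m =
    mmul (leaf_word (tag (leaf_glue m))) (leaf_word (tagged (leaf_glue m))).
Proof.
elim: t s m => [|f IH] s m /=; first by rewrite mul1m.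
by rewrite IH mulmA.
Qed.

Fixpoint depth (t : tree) : nat :=
  match t with Triv => 0 | Node f => (\max_(i < n) depth (f i)).+1 end.

Fixpoint full_tree (N : nat) : tree :=
  if N is N'.+1 then Node (fun _ => full_tree N') else Triv.
End Trees.
Arguments Triv {n}.

Section DecoratedTrees.
Variables (k : fieldType) (n : nat) (V : lmodType (A k n)^c).

Definition path_act (v : V) (p : {fmonom 'I_n}) : V := ract v (<< p >> : A k n).

Lemma path_act1 v : path_act v mone = v. Proof. exact: ract1. Qed.
Lemma path_actM v p q : path_act v (mmul p q) = path_act (path_act v p) q.
Proof. by rewrite /path_act -ractM free_algUM. Qed.
Lemma path_actD u v p : path_act (u + v) p = path_act u p + path_act v p.
Proof. exact: scalerDr. Qed.
Lemma path_act0 p : path_act 0 p = 0. Proof. exact: scaler0. Qed.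

Definition Phi (t : tree n) (v : V) : Leaf t -> V :=
  fun l => path_act v (leaf_word l).

(* Pairs (t, v) with v a decoration of the leaves of t by vectors of V. *)
Definition dtree : Type := {t : tree n & Leaf t -> V}.
Definition dtree_pair (t : tree n) (v : Leaf t -> V) : dtree :=
  existT (fun t => Leaf t -> V) t v.

HB.instance Definition _ := gen_eqMixin dtree.
HB.instance Definition _ := gen_choiceMixin dtree.

Inductive dtree_step : dtree -> dtree -> Prop :=
| Dtree_step (t : tree n) (v : Leaf t -> V) (s : Leaf t -> tree n) :
    dtree_step (dtree_pair v)
      (dtree_pair (t := glue s) (fun m =>
         let lm := leaf_glue m in Phi (v (tag lm)) (tagged lm))).

Definition dtree_eq : dtree -> dtree -> Prop := clos_refl_sym_trans _ dtree_step.

Definition dleaf (v : V) : dtree := dtree_pair (t := Triv) (fun _ => v).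

Definition dnode (d : 'I_n -> dtree) : dtree :=
  dtree_pair (t := Node (fun i => tag (d i)))
    (fun l => tagged (d (tag l)) (tagged l)).

(* The vector at the vertex w of t, for w beyond the leaves of t. *)
Fixpoint val_at (t : tree n) : (Leaf t -> V) -> seq 'I_n -> V :=
  match t return (Leaf t -> V) -> seq 'I_n -> V with
  | Triv => fun v w => path_act (v tt) (FMonom w)
  | Node f => fun v w =>
      if w is i :: w' then
        val_at (fun l => v (@Tagged _ i (fun i => Leaf (f i)) l)) w'
      else 0
  end.

Definition dval (d : dtree) : seq 'I_n -> V := val_at (tagged d).

(* The full tree of depth N, decorated by g; it refines d for g := dval d and
   N >= depth (tag d). *)
Definition dfull (N : nat) (g : seq 'I_n -> V) : dtree :=
  dtree_pair (t := full_tree n N) (fun l => g (leaf_word l)).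

Lemma path_act_cons v i w :
  path_act v (FMonom (i :: w)) = path_act (path_act v (fmu i)) (FMonom w).
Proof.
by rewrite -path_actM; congr path_act; apply/val_inj; rewrite /= fmM fmU.
Qed.

Lemma path_act_nil v : path_act v (FMonom [::]) = v.
Proof.
by rewrite -[RHS]path_act1; congr path_act; apply/val_inj; rewrite /= fm1.
Qed.

Lemma path_act_cat v w u :
  path_act v (FMonom (w ++ u)) = path_act (path_act v (FMonom w)) (FMonom u).
Proof.
by rewrite -path_actM; congr path_act; apply/val_inj; rewrite /= fmM.
Qed.

Lemma depth_child (f : 'I_n -> tree n) i N :
  (depth (Node f) <= N.+1 -> depth (f i) <= N)%N.
Proof. by rewrite /= ltnS => /bigmax_leqP; apply. Qed.

Lemma val_at_cat t (v : Leaf t -> V) w u : (depth t <= size w)%N ->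
  val_at v (w ++ u) = path_act (val_at v w) (FMonom u).
Proof.
elim: t v w => [|f IH] v w; first by move=> _ /=; rewrite path_act_cat.
by case: w => //= i w /depth_child le; rewrite IH.
Qed.

Lemma val_at_Phi t v w : (depth t <= size w)%N ->
  val_at (Phi v : Leaf t -> V) w = path_act v (FMonom w).
Proof.
elim: t v w => [|f IH] v w.
  by move=> _ /=; rewrite /Phi /= path_act1.
case: w => //= i w /depth_child le; rewrite path_act_cons -(IH i) //.
by congr val_at; apply/funext => l; rewrite /Phi /= path_actM.
Qed.

Lemma val_at_glue t (v : Leaf t -> V) (s : Leaf t -> tree n) w :
  (depth (glue s) <= size w)%N ->
  val_at (t := glue s)
    (fun m => let lm := leaf_glue m in Phi (v (tag lm)) (tagged lm)) w =
  val_at v w.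
Proof.
elim: t v s w => [|f IH] v s w.
  exact: (@val_at_Phi (s tt) (v tt) w).
case: w => //= i w /depth_child le.
by rewrite -[RHS](IH i _ (fun l => s (@Tagged _ i (fun i => Leaf (f i)) l))).
Qed.

Lemma glue_full t (v : Leaf t -> V) N : (depth t <= N)%N ->
  exists s : Leaf t -> tree n,
    dtree_pair (t := glue s)
      (fun m => let lm := leaf_glue m in Phi (v (tag lm)) (tagged lm)) =
    dfull N (val_at v).
Proof.
elim: t v N => [|f IH] v N.
  move=> _; exists (fun _ => full_tree n N); congr dtree_pair.
  by apply/funext => l; rewrite /Phi /=; congr path_act; apply: val_inj.
case: N => // N le; pose vi i l := v (@Tagged _ i (fun i => Leaf (f i)) l).
have C i := cid (IH i (vi i) N (depth_child i le)).
pose s i := sval (C i); have sP i := svalP (C i).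
exists (fun l => s (tag l) (tagged l)).
transitivity (dnode (fun i => dfull N (val_at (vi i)))).
  by rewrite -(funext sP).
by congr dtree_pair; apply/funext => -[i l] /=; rewrite fmM fmU.
Qed.

Lemma val_at_full N (g : seq 'I_n -> V) w : (N <= size w)%N ->
  dval (dfull N g) w = path_act (g (take N w)) (FMonom (drop N w)).
Proof.
rewrite /dval /dfull /=; elim: N g w => [|N IH] g w /=.
  by rewrite fm1 take0 drop0.
case: w => //= i w le; rewrite -(IH (fun w => g (i :: w))) //.
by congr val_at; apply/funext => l /=; rewrite fmM fmU.
Qed.

Definition eventually_eq (g h : seq 'I_n -> V) :=
  exists N, forall w, (N <= size w)%N -> g w = h w.

Lemma eventually_eq_trans g2 g1 g3 :
  eventually_eq g1 g2 -> eventually_eq g2 g3 -> eventually_eq g1 g3.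
Proof.
move=> [N1 H1] [N2 H2]; exists (maxn N1 N2) => w.
by rewrite geq_max => /andP[/H1-> /H2->].
Qed.

Lemma eventually_eq_sym g1 g2 : eventually_eq g1 g2 -> eventually_eq g2 g1.
Proof. by move=> [N H]; exists N => w /H. Qed.

Lemma dtree_eq_full d N : (depth (tag d) <= N)%N ->
  dtree_eq d (dfull N (dval d)).
Proof.
case: d => t v le; have [s <-] := glue_full v le.
by apply: rst_step; apply: (Dtree_step v s).
Qed.

Lemma dtree_eqP d d' : dtree_eq d d' <-> eventually_eq (dval d) (dval d').
Proof.
split=> [|[N H]].
  elim=> {d d'} [_ _ [t v s]|d|d d' _|d d' d'' _ + _]; last 3 first.
  - by exists 0%N.
  - exact: eventually_eq_sym.
  - exact: eventually_eq_trans.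
  by exists (depth (glue s)) => w le; apply/esym/val_at_glue.
pose M := maxn N (maxn (depth (tag d)) (depth (tag d'))).
apply: (rst_trans _ _ _ (dfull M (dval d))).
  by apply: dtree_eq_full; rewrite /M !leq_max leqnn !orbT.
apply: rst_sym; rewrite [dfull M (dval d)](_ : _ = dfull M (dval d')).
  by apply: dtree_eq_full; rewrite /M !leq_max leqnn !orbT.
congr dtree_pair; apply/funext => l; apply: H.
apply: leq_trans (leq_maxl N _ : (N <= M)%N) _.
by elim: (M) l => //= m IH [i l] /=; rewrite fmM size_cat fmU ltnS IH.
Qed.
End DecoratedTrees.

Section Pi.
Variables (k : fieldType) (n : nat) (V : lmodType (A k n)^c).
Local Notation dtree := (dtree V).

Definition dtree_eqb : rel dtree := fun d d' => `[< dtree_eq d d' >].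

Fact dtree_eqb_equiv : equiv_class_of dtree_eqb.
Proof.
split=> [d|d d'|d2 d1 d3]; first by apply/asboolP/rst_refl.
  by apply/asboolP/asboolP; apply: rst_sym.
by move=> /asboolP H /asboolP H'; apply/asboolP/(rst_trans _ _ _ _ _ H H').
Qed.
Canonical dtree_eqb_equivRel := EquivRelPack dtree_eqb_equiv.
Canonical dtree_eqb_encModRel := defaultEncModRel dtree_eqb.

Definition Pi_space : Type := {eq_quot dtree_eqb}.
HB.instance Definition _ := Choice.on Pi_space.

(* cls (t, v) is the class [t, v]. *)
Definition cls (d : dtree) : Pi_space := \pi_({eq_quot dtree_eqb}) d.
Definition rep (x : Pi_space) : dtree := repr (x : {eq_quot dtree_eqb}).

Lemma repK x : cls (rep x) = x. Proof. exact: reprK. Qed.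

Lemma cls_eq d d' : cls d = cls d' <-> dtree_eq d d'.
Proof.
split=> [/eqmodP/asboolP//|H].
by apply/eqmodP/asboolP.
Qed.

Lemma cls_evP d d' : cls d = cls d' <-> eventually_eq (dval d) (dval d').
Proof. by rewrite cls_eq dtree_eqP. Qed.

Lemma dval_rep d : exists N, forall w, (N <= size w)%N ->
  dval (rep (cls d)) w = dval d w.
Proof. by apply/cls_evP; rewrite repK. Qed.

(* Both decorated trees are refined to a common full tree, where the
   decorations are added; see cls_add. *)
Definition dadd (d d' : dtree) : dtree :=
  dfull (maxn (depth (tag d)) (depth (tag d')))
    (fun w => dval d w + dval d' w).

Definition dmap (h : V -> V) (d : dtree) : dtree :=
  dtree_pair (fun l => h (tagged d l)).

(* The branch at j of (t, v); (Triv, v) is first refined to the caret decorated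
   by the v e_i. *)
Definition dE (j : 'I_n) (d : dtree) : dtree :=
  match d with
  | existT Triv v => dleaf (path_act (v tt) (fmu j))
  | existT (Node f) v =>
      dtree_pair (t := f j) (fun l => v (@Tagged _ j (fun i => Leaf (f i)) l))
  end.

(* The caret with d at its jth leaf and 0 at the others. *)
Definition dEs (j : 'I_n) (d : dtree) : dtree :=
  dnode (fun i => if i == j then d else dleaf 0).

Lemma dval_add d d' w : (maxn (depth (tag d)) (depth (tag d')) <= size w)%N ->
  dval (dadd d d') w = dval d w + dval d' w.
Proof.
set N := maxn _ _ => le.
have [le1 le2] : (depth (tag d) <= size (take N w))%N /\
                 (depth (tag d') <= size (take N w))%N.
  by rewrite size_takel // leq_maxl leq_maxr.
rewrite /dadd -/N val_at_full // path_actD /dval -!val_at_cat //.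
by rewrite cat_take_drop.
Qed.

Lemma dval_map (h : V -> V) (hP : forall v p, h (path_act v p) = path_act (h v) p)
  (h0 : h 0 = 0) d w : dval (dmap h d) w = h (dval d w).
Proof.
case: d => t v; rewrite /dval /dmap /=.
by elim: t v w => [|f IH] v w /=; [rewrite hP | case: w].
Qed.

Lemma dval_E j d w : dval (dE j d) w = dval d (j :: w).
Proof. by case: d => -[|f] v //; rewrite /dval /= path_act_cons. Qed.

Lemma dval_Es j d i w :
  dval (dEs j d) (i :: w) = if i == j then dval d w else 0.
Proof.
rewrite /dval /=; case: eqP => _ //.
by rewrite /= path_act0.
Qed.

Definition Pi_zero : Pi_space := cls (dleaf 0).
Definition Pi_add (x y : Pi_space) : Pi_space := cls (dadd (rep x) (rep y)).
Definition vscale (c : k) (v : V) : V := ract v (c%:MP : A k n).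
Definition Pi_scale (c : k) (x : Pi_space) : Pi_space :=
  cls (dmap (vscale c) (rep x)).
Definition Pi_opp (x : Pi_space) : Pi_space := Pi_scale (-1) x.
Definition Pi_E (j : 'I_n) (x : Pi_space) : Pi_space := cls (dE j (rep x)).
Definition Pi_Es (j : 'I_n) (x : Pi_space) : Pi_space := cls (dEs j (rep x)).

Lemma vscale_path c v p : vscale c (path_act v p) = path_act (vscale c v) p.
Proof.
rewrite /vscale /path_act -!ractM; congr ract.
by rewrite !malgM_def !fgmulUU mulr1 mul1r mul1m mulm1.
Qed.

Lemma dval_scale c d w : dval (dmap (vscale c) d) w = vscale c (dval d w).
Proof. by apply: dval_map => [v p|]; [apply: vscale_path | apply: scaler0]. Qed.

Lemma dval_0 w : dval (dleaf 0 : dtree) w = 0.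
Proof. by rewrite /dval /= path_act0. Qed.

(* A class is determined by the vectors at all sufficiently long words. *)
Definition has_val (x : Pi_space) (g : seq 'I_n -> V) :=
  eventually_eq (dval (rep x)) g.

Lemma has_val_eq x y g : has_val x g -> has_val y g -> x = y.
Proof.
move=> gx gy; rewrite -(repK x) -(repK y); apply/cls_evP.
exact: eventually_eq_trans gx (eventually_eq_sym gy).
Qed.

Lemma has_val_cls d : has_val (cls d) (dval d).
Proof. exact: dval_rep. Qed.

Lemma has_val_rep x : has_val x (dval (rep x)). Proof. by exists 0%N. Qed.

Lemma has_val_ext x g h : has_val x g -> eventually_eq g h -> has_val x h.
Proof. exact: eventually_eq_trans. Qed.

Lemma has_val0 : has_val Pi_zero (fun _ => 0).
Proof.
apply: has_val_ext (has_val_cls _) _.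
by exists 0%N => w _; apply: dval_0.
Qed.

Lemma has_valD x y g h : has_val x g -> has_val y h ->
  has_val (Pi_add x y) (fun w => g w + h w).
Proof.
move=> [N1 H1] [N2 H2]; apply: has_val_ext (has_val_cls _) _.
set M := maxn (depth (tag (rep x))) (depth (tag (rep y))).
exists (maxn M (maxn N1 N2)) => w; rewrite !geq_max => /and3P[lM l1 l2].
by rewrite dval_add ?H1 ?H2 // geq_max.
Qed.

Lemma has_valZ c x g : has_val x g ->
  has_val (Pi_scale c x) (fun w => vscale c (g w)).
Proof.
move=> [N H]; apply: has_val_ext (has_val_cls _) _.
by exists N => w le; rewrite dval_scale H.
Qed.

Lemma has_valE j x g : has_val x g ->
  has_val (Pi_E j x) (fun w => g (j :: w)).
Proof.
move=> [N H]; apply: has_val_ext (has_val_cls _) _.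
by exists N => w le; rewrite dval_E H //= leqW.
Qed.

Lemma has_valEs j x g : has_val x g -> has_val (Pi_Es j x)
  (fun w => if w is i :: w' then if i == j then g w' else 0 else 0).
Proof.
move=> [N H]; apply: has_val_ext (has_val_cls _) _.
by exists N.+1 => -[|i w] //= le; rewrite dval_Es H.
Qed.

Lemma eventually_eq1 (g h : seq 'I_n -> V) : g =1 h -> eventually_eq g h.
Proof. by move=> H; exists 0%N => w _. Qed.

Fact Pi_addA : associative Pi_add.
Proof.
move=> x y z; apply: has_val_eq
  (has_valD (has_val_rep x) (has_valD (has_val_rep y) (has_val_rep z))) _.
apply: has_val_ext
  (has_valD (has_valD (has_val_rep x) (has_val_rep y)) (has_val_rep z)) _.
by apply: eventually_eq1 => w; rewrite addrA.
Qed.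

Fact Pi_addC : commutative Pi_add.
Proof.
move=> x y; apply: has_val_eq (has_valD (has_val_rep x) (has_val_rep y)) _.
apply: has_val_ext (has_valD (has_val_rep y) (has_val_rep x)) _.
by apply: eventually_eq1 => w; rewrite addrC.
Qed.

Fact Pi_add0 : left_id Pi_zero Pi_add.
Proof.
move=> x; apply: esym (has_val_eq (has_val_rep x) _).
apply: has_val_ext (has_valD has_val0 (has_val_rep x)) _.
by apply: eventually_eq1 => w; rewrite add0r.
Qed.

Lemma vscaleN1 v : vscale (-1) v = - v.
Proof. by rewrite /vscale rmorphN rmorph1 /ract scaleN1r. Qed.

Fact Pi_addN : left_inverse Pi_zero Pi_opp Pi_add.
Proof.
move=> x; apply: esym (has_val_eq has_val0 _).
apply: has_val_ext (has_valD (has_valZ (-1) (has_val_rep x)) (has_val_rep x)) _.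
by apply: eventually_eq1 => w; rewrite vscaleN1 addNr.
Qed.

HB.instance Definition _ := GRing.isZmodule.Build Pi_space
  Pi_addA Pi_addC Pi_add0 Pi_addN.

Fact Pi_scaleA (a b : k) x : Pi_scale a (Pi_scale b x) = Pi_scale (a * b) x.
Proof.
apply: has_val_eq (has_valZ a (has_valZ b (has_val_rep x))) _.
apply: has_val_ext (has_valZ (a * b) (has_val_rep x)) _.
apply: eventually_eq1 => w; rewrite /vscale -ractM; congr ract.
by rewrite mulrC rmorphM.
Qed.

Fact Pi_scale1 : left_id 1 Pi_scale.
Proof.
move=> x; apply: esym (has_val_eq (has_val_rep x) _).
apply: has_val_ext (has_valZ 1 (has_val_rep x)) _.
by apply: eventually_eq1 => w; rewrite /vscale rmorph1 ract1.
Qed.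

Fact Pi_scaleDr : right_distributive Pi_scale +%R.
Proof.
move=> a x y; apply: has_val_eq
  (has_valZ a (has_valD (has_val_rep x) (has_val_rep y))) _.
apply: has_val_ext
  (has_valD (has_valZ a (has_val_rep x)) (has_valZ a (has_val_rep y))) _.
by apply: eventually_eq1 => w; rewrite /vscale /ract scalerDr.
Qed.

Fact Pi_scaleDl x : {morph Pi_scale^~ x : a b / a + b}.
Proof.
move=> a b; apply: has_val_eq (has_valZ (a + b) (has_val_rep x)) _.
apply: has_val_ext
  (has_valD (has_valZ a (has_val_rep x)) (has_valZ b (has_val_rep x))) _.
by apply: eventually_eq1 => w; rewrite /vscale rmorphD /ract scalerDl.
Qed.

HB.instance Definition _ := GRing.Zmodule_isLmodule.Build k Pi_space
  Pi_scaleA Pi_scale1 Pi_scaleDr Pi_scaleDl.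

Fact Pi_E_is_linear j : linear (Pi_E j).
Proof.
move=> a x y; apply: has_val_eq (has_valE j
  (has_valD (has_valZ a (has_val_rep x)) (has_val_rep y))) _.
exact: has_valD (has_valZ a (has_valE j (has_val_rep x)))
  (has_valE j (has_val_rep y)).
Qed.
HB.instance Definition _ j := GRing.isLinear.Build k Pi_space Pi_space *:%R
  (Pi_E j) (Pi_E_is_linear j).

Lemma vscale0 c : vscale c 0 = 0. Proof. exact: scaler0. Qed.

Fact Pi_Es_is_linear j : linear (Pi_Es j).
Proof.
move=> a x y; apply: has_val_eq (has_valEs j
  (has_valD (has_valZ a (has_val_rep x)) (has_val_rep y))) _.
apply: has_val_ext (has_valD (has_valZ a (has_valEs j (has_val_rep x)))
  (has_valEs j (has_val_rep y))) _.
apply: eventually_eq1 => -[|i w]; first by rewrite vscale0 addr0.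
by case: eqP => // _; rewrite vscale0 addr0.
Qed.
HB.instance Definition _ j := GRing.isLinear.Build k Pi_space Pi_space *:%R
  (Pi_Es j) (Pi_Es_is_linear j).

Definition Pi_op (x : LX n) : {linear Pi_space -> Pi_space} :=
  match x with inl i => Pi_E i | inr i => Pi_Es i end.

Lemma has_val_sum (J : Type) (r : seq J) (x : J -> Pi_space)
  (g : J -> seq 'I_n -> V) : (forall j, has_val (x j) (g j)) ->
  has_val (\sum_(j <- r) x j) (fun w => \sum_(j <- r) g j w).
Proof.
move=> H; elim: r => [|j r IH].
  rewrite big_nil; apply: has_val_ext has_val0 _.
  by apply: eventually_eq1 => w; rewrite big_nil.
rewrite big_cons; apply: has_val_ext (has_valD (H j) IH) _.
by apply: eventually_eq1 => w; rewrite big_cons.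
Qed.

Lemma Pi_EsK i j x : Pi_E j (Pi_Es i x) = if i == j then x else 0.
Proof.
apply: has_val_eq (has_valE j (has_valEs i (has_val_rep x))) _.
rewrite eq_sym; case: eqP => _; first exact: has_val_rep.
exact: has_val0.
Qed.

Lemma Pi_EK x : \sum_(i < n) Pi_Es i (Pi_E i x) = x.
Proof.
apply: esym (has_val_eq (has_val_rep x) _).
apply: has_val_ext (has_val_sum _
  (fun i => has_valEs i (has_valE i (has_val_rep x)))) _.
exists 1%N => -[|i w] // _.
rewrite (bigD1 i) //= eqxx big1 ?addr0 // => j.
by rewrite eq_sym => /negbTE->.
Qed.

Lemma Pi_op_satisfies : satisfies Pi_op (@leavitt_relation k n).
Proof.
move=> f [|i j] x.
  rewrite op_actD op_actN op_act1 op_act_sum.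
  under eq_bigr do rewrite op_actM !op_act_gen.
  by rewrite Pi_EK subrr.
rewrite op_actD op_actN op_actM !op_act_gen /= Pi_EsK.
case: eqP => _; first by rewrite op_act1 subrr.
by rewrite op_act0 subr0.
Qed.

Definition Pi_obj : lmodType (L k n)^c := op_module Pi_op_satisfies.

Lemma cls_add (t : tree n) (v v' : Leaf t -> V) :
  cls (dtree_pair (fun l => v l + v' l)) =
  cls (dtree_pair v) + cls (dtree_pair v').
Proof.
apply: has_val_eq (has_val_cls _) _.
apply: has_val_ext (has_valD (has_val_cls _) (has_val_cls _)) _.
apply: eventually_eq1 => w; rewrite /dval /=.
elim: t v v' w => [|f IH] v v' w /=; first by rewrite path_actD.
by case: w => [|i w]; rewrite ?addr0 // IH.
Qed.

Lemma cls_scale (c : k) (t : tree n) (v : Leaf t -> V) :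
  cls (dtree_pair (fun l => ract (v l) (c%:MP : A k n))) =
  c *: cls (dtree_pair v).
Proof.
apply: has_val_eq (has_val_cls _) _.
apply: has_val_ext (has_valZ c (has_val_cls _)) _.
by apply: eventually_eq1 => w; rewrite -dval_scale.
Qed.

Lemma cls_E (d : 'I_n -> dtree) j :
  ract (cls (dnode d) : Pi_obj) (iota k n (gen k j)) = cls (d j).
Proof.
rewrite iota_gen op_module_ract op_act_gen /=.
apply: has_val_eq (has_valE j (has_val_cls _)) _.
by apply: has_val_ext (has_val_cls _) _; apply: eventually_eq1.
Qed.

Lemma cls_Es (d : dtree) j :
  ract (cls d : Pi_obj) (to_quot (@leavitt_relation k n) (gen k (inr j : LX n)))
  = cls (dnode (fun i => if i == j then d else dleaf 0)).
Proof.
rewrite op_module_ract op_act_gen /=.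
apply: has_val_eq (has_valEs j (has_val_cls _)) _.
apply: has_val_ext (has_val_cls _) _.
by exists 1%N => -[|i w] // _; rewrite dval_Es.
Qed.
End Pi.

Section PiFunctor.
Variables (k : fieldType) (n : nat).

Section Morphism.
Variables (V W : lmodType (A k n)^c) (theta : {linear V -> W}).

Definition dtree_map (d : dtree V) : dtree W :=
  dtree_pair (fun l => theta (tagged d l)).

Lemma dval_dtree_map d w : dval (dtree_map d) w = theta (dval d w).
Proof.
case: d => t v; rewrite /dval /dtree_map /=.
elim: t v w => [|f IH] v w /=; first by rewrite /path_act /ract linearZ.
by case: w => [|i w]; rewrite ?linear0 // IH.
Qed.

Definition Pi_fun (x : Pi_space V) : Pi_space W := cls (dtree_map (rep x)).

Lemma has_val_Pi_fun x g : has_val x g ->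
  has_val (Pi_fun x) (fun w => theta (g w)).
Proof.
move=> [N H]; apply: has_val_ext (has_val_cls _) _.
by exists N => w le; rewrite dval_dtree_map H.
Qed.

Lemma Pi_fun_cls (t : tree n) (v : Leaf t -> V) :
  Pi_fun (cls (dtree_pair v)) = cls (dtree_pair (fun l => theta (v l))).
Proof.
apply: has_val_eq (has_val_Pi_fun (has_val_cls _)) _.
apply: has_val_ext (has_val_cls _) _.
by apply: eventually_eq1 => w; rewrite -dval_dtree_map.
Qed.

Fact Pi_fun_is_linear : linear Pi_fun.
Proof.
move=> a x y; apply: has_val_eq (has_val_Pi_fun
  (has_valD (has_valZ a (has_val_rep x)) (has_val_rep y))) _.
apply: has_val_ext (has_valD (has_valZ a (has_val_Pi_fun (has_val_rep x)))
  (has_val_Pi_fun (has_val_rep y))) _.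
by apply: eventually_eq1 => w; rewrite /vscale /ract linearP.
Qed.
HB.instance Definition _ := GRing.isLinear.Build k (Pi_space V) (Pi_space W)
  *:%R Pi_fun Pi_fun_is_linear.

Lemma Pi_fun_op x u : Pi_fun (Pi_op V x u) = Pi_op W x (Pi_fun u).
Proof.
case: x => j /=.
  apply: has_val_eq (has_val_Pi_fun (has_valE j (has_val_rep u))) _.
  exact: has_valE (has_val_Pi_fun (has_val_rep u)).
apply: has_val_eq (has_val_Pi_fun (has_valEs j (has_val_rep u))) _.
apply: has_val_ext (has_valEs j (has_val_Pi_fun (has_val_rep u))) _.
apply: eventually_eq1 => -[|i w]; first by rewrite linear0.
by case: eqP; rewrite ?linear0.
Qed.

Definition Pi_hom : {linear Pi_obj V -> Pi_obj W} :=
  @op_fun _ _ _ _ _ _ _ (@Pi_op_satisfies k n V) (@Pi_op_satisfies k n W)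
    Pi_fun Pi_fun_op.
End Morphism.

Definition Pi : functor (Rep (A k n)) (Rep (L k n)).
Proof.
refine (@Functor (Rep (A k n)) (Rep (L k n)) (fun V => Pi_obj V)
  (fun V W theta => Pi_hom theta) _ _).
- move=> V; apply: linear_ext => x.
  apply: has_val_eq (has_val_Pi_fun (idfun : {linear V -> V}) (has_val_rep x)) _.
  exact: has_val_rep.
- move=> U V W g f; apply: linear_ext => x.
  apply: has_val_eq
    (has_val_Pi_fun (g \o f : {linear U -> W}) (has_val_rep x)) _.
  exact: (has_val_Pi_fun g (has_val_Pi_fun f (has_val_rep x))).
Defined.

Definition Lambda : functor (Rep (L k n)) (Rep (A k n)) := Restr (iota k n).
End PiFunctor.

Section Complete.
Variables (k : fieldType) (n : nat).
Implicit Types V W : lmodType (A k n)^c.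

(* j_V *)
Definition can_map V (v : V) : Pi_obj V := cls (dleaf v).

Definition complete V (S : submodClosed V) : Prop :=
  forall v, exists2 m : nat, (1 <= m)%N &
    forall p : {fmonom 'I_n}, (m <= fdeg p)%N -> path_act v p \in S.

Definition smallest_complete V (S : submodClosed V) : Prop :=
  complete S /\
  forall S' : submodClosed V, complete S' -> {subset S <= S'}.

Definition class_S V : Prop := exists S : submodClosed V, smallest_complete S.

Definition full V : Prop :=
  forall S : submodClosed V, complete S -> forall v, v \in S.

Definition nondegenerate V : Prop := injective (@can_map V).

Definition full_nd V : Prop := full V /\ nondegenerate V.

Section Preimage.
Variables (V W : lmodType (A k n)^c) (theta : {linear V -> W}).
Variable S : submodClosed W.

Definition preim_pred : {pred V} := [pred v | theta v \in S].
Fact preim_submod_closed : submod_closed preim_pred.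
Proof.
split=> [|a u v]; rewrite !inE ?linear0 ?rpred0 // => uS vS.
by rewrite linearP rpredD // rpredZ.
Qed.
HB.instance Definition _ := GRing.isSubmodClosed.Build (A k n)^c V preim_pred
  preim_submod_closed.

Lemma preim_complete : complete S -> complete preim_pred.
Proof.
move=> cS v; have [m m1 H] := cS (theta v); exists m => // p le.
by rewrite inE /path_act /ract linearZ; apply: H.
Qed.
End Preimage.

(* V_s, for V in the class S. *)
Definition core V (hV : class_S V) : submodClosed V := sval (cid hV).

Lemma coreP V (hV : class_S V) : smallest_complete (core hV).
Proof. exact: svalP (cid hV). Qed.

Section SigmaMorphism.
Variables (V W : lmodType (A k n)^c) (hV : class_S V) (hW : class_S W).
Variable theta : {linear V -> W}.

Fact Sigma_subproof (v : submod (core hV)) : theta (val v) \in core hW.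
Proof.
have [_ /(_ _ (preim_complete theta (coreP hW).1))] := coreP hV.
by move=> /(_ (val v) (valP v)).
Qed.

Definition Sigma_fun (v : submod (core hV)) : submod (core hW) :=
  Submod (Sigma_subproof v).

Fact Sigma_fun_is_linear : linear Sigma_fun.
Proof. by move=> a u v; apply: val_inj; rewrite /= linearP. Qed.
HB.instance Definition _ := GRing.isLinear.Build (A k n)^c
  (submod (core hV)) (submod (core hW)) _ Sigma_fun Sigma_fun_is_linear.
End SigmaMorphism.

Definition Rep_S : category := full_subcategory (C := Rep (A k n)) class_S.

Definition Sigma : functor Rep_S (Rep (A k n)).
Proof.
refine (@Functor Rep_S (Rep (A k n))
  (fun X => submod (core (svalP X)) : lmodType (A k n)^c)
  (fun X Y theta => @Sigma_fun _ _ (svalP X) (svalP Y) theta :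
     {linear submod (core (svalP X)) -> submod (core (svalP Y))}) _ _);
  by move=> *; apply: linear_ext => x; apply: val_inj.
Defined.

Definition Rep_full_nd : category :=
  full_subcategory (C := Rep (A k n)) full_nd.

Definition in_Rep_S_L (W : Rep (L k n)) : Prop :=
  exists2 V : Rep (A k n), class_S V & W = Pi k n V.

Definition Rep_S_L : category := full_subcategory in_Rep_S_L.

Definition Pi_restr : functor Rep_full_nd (Rep (L k n)) :=
  restrict (C := Rep (A k n)) full_nd (Pi k n).

Definition Lambda_restr : functor Rep_S_L (Rep (A k n)) :=
  restrict in_Rep_S_L (Lambda k n).
End Complete.

(* Main.v *)
(* Call a word w long for x in Pi(V) if it reaches the leaves of a tree
   representing x; then x.w = j_V(x_w), where x_w is the vector of V at w.  So
   j_V(V) is complete in Lambda(Pi(V)).  A complete submodule of Lambda(Pi(V))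
   pulls back along j_V to a complete submodule of V, and complete submodules of
   a complete submodule are complete; hence j_V(V_s) is the smallest complete
   submodule of Lambda(Pi(V)).  For V full and nondegenerate this gives
   V = Sigma(Lambda(Pi(V))) through j_V.
   In an L-module W, y = sum_i y.e_i.e_i^*, so y is determined by the vectors
   y.w for all long w.  An A-linear theta : U -> Lambda(W) therefore extends to
   a unique L-linear map Pi(U) -> W sending x to the y with y.w = theta(x_w) for
   long w; it is injective if theta is, and surjective if theta(U) is complete.
   Both hold for the inclusion of Sigma(Lambda(W)), which gives
   Pi(Sigma(Lambda(W))) = W. *)
From HB Require Import structures.
From mathcomp Require Import all_boot all_order all_algebra.
From mathcomp Require Import finmap monalg.
From mathcomp Require Import boolp.
Require Import Defs.

Set Implicit Arguments.
Unset Strict Implicit.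
Unset Printing Implicit Defensive.

Import GRing.Theory.
Local Open Scope ring_scope.

(** * Isomorphisms of functors and modules, and induction in the free algebra *)

Lemma naturally_isomorphic_sym (C D : category) (F G : functor C D) :
  naturally_isomorphic F G -> naturally_isomorphic G F.
Proof.
move=> [eta [nat iso]].
have [inv [invl invr]] : exists inv : forall X, hom (G X) (F X),
    (forall X, comp (inv X) (eta X) = idm _) /\
    (forall X, comp (eta X) (inv X) = idm _).
  exists (fun X => sval (cid (iso X))).
  by split=> X; have [] := svalP (cid (iso X)).
exists inv; split=> [X Y f|X]; last by exists (eta X).
rewrite -[LHS]comp_idr -(invr X) -compA.
by rewrite [comp (fmor G f) _]compA -nat !compA invl comp_idl.
Qed.

Section InverseLinear.
Variables (R : pzRingType) (U V : lmodType R).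
Variables (f : {linear U -> V}) (g : V -> U).
Hypotheses (fK : cancel f g) (gK : cancel g f).

(** The body retains both cancellation proofs so that the linear structure can be inferred from the
    term. *)
Definition inverse_linear : V -> U := let _ := (fK, gK) in g.

Fact inverse_linear_is_linear : linear inverse_linear.
Proof. exact: can2_linear fK gK. Qed.
HB.instance Definition _ := GRing.isLinear.Build R V U *:%R inverse_linear
  inverse_linear_is_linear.
End InverseLinear.

Lemma bijective_is_iso (R : pzRingType) (U V : Rep R) (f : hom U V) :
  injective (f : {linear U -> V}) ->
  (forall v, exists u, (f : {linear U -> V}) u = v) -> is_iso f.
Proof.
move=> inj surj; pose g v := sval (cid (surj v)).
have gK : cancel g (f : {linear U -> V}).
  by move=> v; exact: svalP (cid (surj v)).
have fK : cancel (f : {linear U -> V}) g by move=> u; apply: inj; rewrite gK.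
exists (inverse_linear fK gK : {linear _ -> _}).
by split; apply: linear_ext => x /=; [apply: fK | apply: gK].
Qed.

Lemma ractD (R : pzRingType) (M : lmodType R^c) (v : M) (a b : R) :
  ract v (a + b) = ract v a + ract v b.
Proof. exact: (scalerDl v (a : R^c)). Qed.

(** An element is a finite sum of scalars times words, and a word is a product of generators. *)
Lemma free_alg_ind (k : fieldType) (X : choiceType)
    (P : free_alg k X -> Prop) :
  (forall c : k, P c%:MP) -> (forall x, P (gen k x)) ->
  (forall f g, P f -> P g -> P (f + g)) ->
  (forall f g, P f -> P g -> P (f * g)) -> forall f, P f.
Proof.
move=> PC Pg PD PM f.
have P0 : P 0 by rewrite -[0](@malgC0E {fmonom X} k); apply: PC.
rewrite (monalgE f); apply: (big_ind P) => // -[w] _.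
have -> : << f@_(FMonom w) *g FMonom w >> =
    (f@_(FMonom w))%:MP * << FMonom w >> :> free_alg k X.
  by rewrite malgM_def fgmulUU mulr1 mul1m.
apply: (PM) => //; elim: w => [|x w IH].
  have -> : FMonom [::] = mone :> {fmonom X} by apply/val_inj; rewrite /= fm1.
  exact: PC.
have -> : << FMonom (x :: w) >> = gen k x * << FMonom w >> :> free_alg k X.
  by rewrite free_algUM; congr << _ >>; apply/val_inj; rewrite /= fmM fmU.
exact: PM.
Qed.

(** * Modules over the Leavitt algebra *)

Section LeavittModules.
Variables (k : fieldType) (n : nat).

Definition star (i : 'I_n) : L k n :=
  to_quot (@leavitt_relation k n) (gen k (inr i : LX n)).

Lemma leavitt_ind (P : L k n -> Prop) :
  (forall c : k, P (iota k n c%:MP)) ->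
  (forall i, P (iota k n (gen k i))) -> (forall i, P (star i)) ->
  (forall a b, P a -> P b -> P (a + b)) ->
  (forall a b, P a -> P b -> P (a * b)) -> forall a, P a.
Proof.
move=> PC PE PEs PD PM a; rewrite -[a]of_quotK; elim/free_alg_ind: (of_quot a).
- by move=> c; rewrite -iota_const.
- by case=> i; [rewrite -iota_gen | apply: PEs].
- by move=> f g Pf Pg; rewrite to_quotD; apply: PD.
- by move=> f g Pf Pg; rewrite rmorphM; apply: PM.
Qed.

Lemma star_gen i j : star i * iota k n (gen k j) = (i == j)%:R.
Proof.
rewrite iota_gen /star -[RHS](rmorph_nat (@to_quot _ (@leavitt_relation k n))).
rewrite -rmorphM; apply/to_quot_eq; apply: Ideal_gen; exact: Leavitt_orth.
Qed.

Lemma sum_gen_star : \sum_(i < n) iota k n (gen k i) * star i = 1.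
Proof.
transitivity (to_quot (@leavitt_relation k n)
    (\sum_(i < n) gen k (inl i : LX n) * gen k (inr i : LX n))).
  by rewrite rmorph_sum; apply: eq_bigr => i _; rewrite iota_gen -rmorphM.
by apply/to_quot_eq; apply: Ideal_gen; exact: Leavitt_sum.
Qed.

Variable W : lmodType (L k n)^c.
Local Notation resW := (Lambda k n W : lmodType (A k n)^c).

Lemma ract_suml (R : pzRingType) (M : lmodType R^c) (J : Type) (r : seq J)
    (v : J -> M) (a : R) :
  ract (\sum_(j <- r) v j) a = \sum_(j <- r) ract (v j) a.
Proof. exact: scaler_sumr. Qed.

Lemma star_sum (y : W) :
  \sum_(i < n) ract (ract y (iota k n (gen k i))) (star i) = y.
Proof.
under eq_bigr do rewrite -ractM.
by rewrite -[RHS]ract1 -sum_gen_star /ract -scaler_suml.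
Qed.

(** Together with [star_sum], this identifies [W] with [n] copies of itself through the actions of
    the [e_i]. *)
Lemma gen_sum_star (y : 'I_n -> W) j :
  ract (\sum_(i < n) ract (y i) (star i)) (iota k n (gen k j)) = y j.
Proof.
rewrite ract_suml (bigD1 j) //= -ractM star_gen eqxx ract1 big1 ?addr0 // => i.
by rewrite -ractM star_gen => /negbTE->; rewrite /ract scale0r.
Qed.

Lemma path_act_restr_cons (y : resW) i w :
  path_act y (FMonom (i :: w)) =
  path_act (ract (y : W) (iota k n (gen k i)) : resW) (FMonom w).
Proof. by rewrite path_act_cons. Qed.

(** Induction on the bound: passing to the vectors [y.e_i] and [z.e_i] lowers it by one, and
    [star_sum] rebuilds [y] and [z] from them. *)
Lemma eventually_eq_path_act (y z : resW) :
  eventually_eq (fun w => path_act y (FMonom w))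
                (fun w => path_act z (FMonom w)) -> y = z.
Proof.
move=> [N]; elim: N y z => [|N IH] y z H.
  by have := H [::] (leq0n _); rewrite !path_act_nil.
rewrite -[y]star_sum -[z]star_sum; apply: eq_bigr => i _.
apply: (congr1 (fun u : W => ract u (star i))).
by apply: IH => w le; rewrite -!path_act_restr_cons; apply: H.
Qed.

End LeavittModules.

(** * Complete submodules *)

Section Completeness.
Variables (k : fieldType) (n : nat).
Implicit Types V W : lmodType (A k n)^c.

Lemma linear_path_act V W (theta : {linear V -> W}) v p :
  theta (path_act v p) = path_act (theta v) p.
Proof. by rewrite /path_act /ract linearZ. Qed.

Definition eventually_in W (P : W -> Prop) (v : W) : Prop :=
  exists N, forall w, (N <= size w)%N -> P (path_act v (FMonom w)).

Lemma eventually_in_prefix W (P : W -> Prop) N v :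
  (forall w, size w = N -> eventually_in P (path_act v (FMonom w))) ->
  eventually_in P v.
Proof.
elim: N v => [|N IH] v H; first by have := H [::] erefl; rewrite path_act_nil.
have C i : eventually_in P (path_act v (fmu i)).
  by apply: IH => w sw; rewrite -path_act_cons; apply: H; rewrite /= sw.
(* Finitely many letters admit a common bound; the successor accounts for the first letter. *)
pose m i := sval (cid (C i)); exists (\max_i m i).+1 => -[|i w] //= le.
rewrite path_act_cons; apply: (svalP (cid (C i)) w).
exact: leq_trans (leq_bigmax i) le.
Qed.

Lemma completeP W (S : submodClosed W) :
  complete S <-> forall v, eventually_in (fun u => u \in S) v.
Proof.
split=> H v.
  by have [N _ HN] := H v; exists N => w le; exact: HN.
have [N HN] := H v; exists N.+1 => // -[w] le; exact: HN (ltnW le).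
Qed.

Section Image.
Variables (V W : lmodType (A k n)^c) (theta : {linear V -> W}).
Variable S : submodClosed V.

Definition image_pred : {pred W} :=
  fun w => `[< exists2 v, v \in S & theta v = w >].

Lemma image_predP w :
  reflect (exists2 v, v \in S & theta v = w) (w \in image_pred).
Proof. exact: asboolP. Qed.

Fact image_submod_closed : submod_closed image_pred.
Proof.
split=> [|a u v]; last first.
  move=> /image_predP[x xS <-] /image_predP[y yS <-]; apply/image_predP.
  by exists (a *: x + y); rewrite ?linearP // rpredD // rpredZ.
by apply/image_predP; exists 0; rewrite ?rpred0 ?linear0.
Qed.
HB.instance Definition _ := GRing.isSubmodClosed.Build (A k n)^c W image_pred
  image_submod_closed.

(** Long words carry [w] into the image of [theta], and longer ones carry a preimage into [S];
    [eventually_in_prefix] makes the second bound uniform over the words of length [N]. *)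
Lemma image_complete :
  (forall w, eventually_in (fun u => exists v, theta v = u) w) ->
  complete S -> complete image_pred.
Proof.
move=> dense cS; apply/completeP => w; have [N HN] := dense w.
apply: (@eventually_in_prefix _ _ N) => u su.
have [v <-] := HN u (eq_leq (esym su)).
have [M HM] := (completeP S).1 cS v; exists M => p le.
by apply/image_predP; exists (path_act v (FMonom p));
  [apply: HM | apply: linear_path_act].
Qed.
End Image.

(** A complete submodule of [S] is still complete in [V], because long words enter [S] first;
    minimality of [S] concludes. *)
Lemma smallest_complete_full V (S : submodClosed V) :
  smallest_complete S -> full (submod S : lmodType (A k n)^c).
Proof.
move=> [cS minS] T cT u.
have dense : forall v, eventually_in
    (fun v' => exists t : submod S, (val : {linear _ -> V}) t = v') v.
  move=> v; have [N HN] := (completeP S).1 cS v; exists N => w le.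
  by exists (Submod (HN w le)).
have /image_predP[t tT /val_inj <-//] :=
  minS _ (image_complete dense cT) _ (valP u).
Qed.

Definition setT_pred V : {pred V} := fun _ => true.

Fact setT_submod_closed V : submod_closed (@setT_pred V).
Proof. by []. Qed.
HB.instance Definition _ V := GRing.isSubmodClosed.Build (A k n)^c V
  (@setT_pred V) (@setT_submod_closed V).

Lemma setT_complete V : complete (@setT_pred V).
Proof. by move=> v; exists 1%N. Qed.

Lemma full_class_S V : full V -> class_S V.
Proof.
move=> fV; exists (@setT_pred V : submodClosed V).
split=> [|S cS v _]; first exact: setT_complete.
exact: fV.
Qed.

Variable V : lmodType (A k n)^c.

Lemma has_val_path_act (x : Pi_obj V) g w : has_val x g ->
  has_val (path_act (x : Lambda k n (Pi_obj V)) (FMonom w) : Pi_space V)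
          (fun u => g (w ++ u)).
Proof.
elim: w x g => [|i w IH] x g H.
  by rewrite path_act_nil.
rewrite path_act_restr_cons.
apply: (IH _ (fun u => g (i :: u))).
rewrite iota_gen op_module_ract op_act_gen /=; exact: has_valE.
Qed.

Fact can_map_is_linear :
  linear (@can_map k n V : V -> (Lambda k n (Pi_obj V) : lmodType (A k n)^c)).
Proof.
have canD (u v : V) : can_map (u + v) = can_map u + can_map v.
  exact: (cls_add (fun _ : Leaf Triv => u) (fun _ => v)).
suff canZ (a : A k n) (u : V) :
    can_map (ract u a) = ract (can_map u) (iota k n a).
  by move=> a u v; rewrite canD; congr (_ + _); apply: canZ.
move: a u; apply: (free_alg_ind (P := fun a : A k n => forall u,
  can_map (ract u a) = ract (can_map u) (iota k n a)))
  => [c|i|a b IHa IHb|a b IHa IHb] u.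
- rewrite iota_const op_module_ract op_actU fm1 /=.
  exact: (cls_scale c (fun _ : Leaf Triv => u)).
- rewrite iota_gen op_module_ract op_act_gen /=.
  apply: has_val_eq (has_val_cls _) _.
  apply: has_val_ext (has_valE i (has_val_cls _)) _.
  apply: eventually_eq1 => w; rewrite /dval /= path_act_cons; congr path_act.
- by rewrite ractD canD IHa IHb rmorphD ractD.
- by rewrite rmorphM !ractM IHb IHa.
Qed.
HB.instance Definition _ := GRing.isLinear.Build (A k n)^c V
  (Lambda k n (Pi_obj V) : lmodType (A k n)^c) *:%R
  (@can_map k n V) can_map_is_linear.

End Completeness.

(** * Density of the canonical map *)

Section CanonicalMap.
Variables (k : fieldType) (n : nat) (V : lmodType (A k n)^c).

(** Past the leaves of a tree the values continue by the action of [A], exactly as on a trivial tree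
    decorated by the vector at [w]. *)
Lemma path_act_can_map (x : Lambda k n (Pi_obj V)) :
  exists N, forall w, (N <= size w)%N ->
    path_act x (FMonom w) = can_map (dval (rep (x : Pi_space V)) w).
Proof.
exists (depth (tag (rep (x : Pi_space V)))) => w le.
apply: has_val_eq (has_val_path_act w (has_val_rep _)) _.
apply: has_val_ext (has_val_cls _) _; apply: eventually_eq1 => u.
by rewrite [RHS]val_at_cat.
Qed.

Lemma can_map_dense (x : Lambda k n (Pi_obj V)) :
  eventually_in
    (fun y => exists v : V, (can_map v : Lambda k n (Pi_obj V)) = y) x.
Proof.
have [N HN] := path_act_can_map x; exists N => w le.
by exists (dval (rep (x : Pi_space V)) w); rewrite HN.
Qed.

End CanonicalMap.

(** * Extension of [A]-linear maps to [Pi(U)] *)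

Section Extension.
Variables (k : fieldType) (n : nat).
Variables (U : lmodType (A k n)^c) (W : lmodType (L k n)^c).
Local Notation resW := (Lambda k n W : lmodType (A k n)^c).
Variable theta : {linear U -> resW}.

(** By [eventually_eq_path_act], [g] determines [y]; existence of [y] is the separate matter of
    [follows_dval]. *)
Definition follows (y : resW) (g : seq 'I_n -> U) : Prop :=
  eventually_eq (fun w => path_act y (FMonom w)) (fun w => theta (g w)).

Lemma follows_ext y g h : follows y g -> eventually_eq g h -> follows y h.
Proof.
move=> yg [N H]; apply: eventually_eq_trans yg _.
by exists N => w /H->.
Qed.

Lemma followsD y z g h : follows y g -> follows z h ->
  follows (y + z) (fun w => g w + h w).
Proof.
move=> [N1 H1] [N2 H2]; exists (maxn N1 N2) => w.
by rewrite geq_max => /andP[/H1 e1 /H2 e2]; rewrite path_actD e1 e2 linearD.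
Qed.

Lemma followsZ c y g : follows y g ->
  follows (ract (y : W) (iota k n c%:MP)) (fun w => vscale c (g w)).
Proof.
move=> [N H]; exists N => w /H e.
transitivity (vscale c (path_act y (FMonom w))); first by rewrite vscale_path.
rewrite e; exact: esym (linearZ_LR theta _ _).
Qed.

Lemma followsE j y g : follows y g ->
  follows (ract (y : W) (iota k n (gen k j))) (fun w => g (j :: w)).
Proof.
move=> [N H]; exists N => w le; rewrite -path_act_restr_cons H //.
exact: leqW.
Qed.

(** The action of [e_i] picks [y i] out of the sum; the successor in the bound excludes the empty
    word, where the value is the arbitrary [u]. *)
Lemma follows_node (y : 'I_n -> resW) (g : 'I_n -> seq 'I_n -> U) (u : U) :
  (forall i, follows (y i) (g i)) ->
  follows (\sum_(i < n) ract (y i : W) (star k i) : W)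
    (fun w => if w is i :: w' then g i w' else u).
Proof.
move=> H; pose N i := sval (cid (H i)); exists (\max_i N i).+1.
move=> -[|i w] //= le; rewrite path_act_restr_cons gen_sum_star.
apply: (svalP (cid (H i)) w).
exact: leq_trans (leq_bigmax i) le.
Qed.

Lemma follows0 : follows 0 (fun _ => 0).
Proof. by exists 0%N => w _; rewrite path_act0 linear0. Qed.

Lemma followsEs j y g : follows y g ->
  follows (ract (y : W) (star k j))
    (fun w => if w is i :: w' then if i == j then g w' else 0 else 0).
Proof.
move=> H; pose y' i : resW := if i == j then y else 0.
have -> : ract (y : W) (star k j) = \sum_(i < n) ract (y' i : W) (star k i).
  rewrite (bigD1 j) //= /y' eqxx big1 ?addr0 // => i /negbTE->.
  exact: scaler0.
apply: follows_ext
  (follows_node (g := fun i w => if i == j then g w else 0) 0 _) _.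
  by move=> i; rewrite /y'; case: eqP => _ //; apply: follows0.
exact: eventually_eq1.
Qed.

(** Induction on the tree: a leaf gives [theta] of its vector, a node the sum of the [y_i.e_i^*]
    over its branches. *)
Lemma follows_dval (d : dtree U) : exists y : resW, follows y (dval d).
Proof.
case: d => t v; elim: t v => [|f IH] v.
  by exists (theta (v tt)); exists 0%N => w _; rewrite -linear_path_act.
pose vi i l := v (@Tagged _ i (fun i => Leaf (f i)) l).
pose y i : resW := sval (cid (IH i (vi i))).
exists (\sum_(i < n) ract (y i : W) (star k i) : W).
exact: (follows_node 0 (fun i => svalP (cid (IH i (vi i))))).
Qed.

Definition Pi_ext (x : Pi_obj U) : W :=
  sval (cid (follows_dval (rep (x : Pi_space U)))).

Lemma Pi_extP x g : has_val (x : Pi_space U) g -> follows (Pi_ext x) g.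
Proof. exact: follows_ext (svalP (cid (follows_dval _))). Qed.

Lemma Pi_ext_eq x y g :
  has_val (x : Pi_space U) g -> follows y g -> Pi_ext x = y.
Proof.
move=> /Pi_extP xg yg; apply: eventually_eq_path_act.
exact: eventually_eq_trans xg (eventually_eq_sym yg).
Qed.

Fact Pi_ext_is_linear : linear Pi_ext.
Proof.
have extD x y : Pi_ext (x + y) = Pi_ext x + Pi_ext y.
  apply: Pi_ext_eq (has_valD (has_val_rep _) (has_val_rep _)) _.
  by apply: followsD; apply: Pi_extP; apply: has_val_rep.
suff extZ (a : L k n) x : Pi_ext (ract x a) = ract (Pi_ext x) a.
  by move=> a x y; rewrite extD; congr (_ + _); apply: extZ.
move: a x; apply: (leavitt_ind (P := fun a => forall x,
  Pi_ext (ract x a) = ract (Pi_ext x) a)) => [c|i|i|a b IHa IHb|a b IHa IHb] x.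
- apply: (@Pi_ext_eq _ _ (fun w => vscale c (dval (rep (x : Pi_space U)) w))).
    rewrite iota_const op_module_ract op_actU fm1 /=.
    exact: has_valZ (has_val_rep _).
  exact: followsZ (Pi_extP (has_val_rep _)).
- apply: (@Pi_ext_eq _ _ (fun w => dval (rep (x : Pi_space U)) (i :: w))).
    rewrite iota_gen op_module_ract op_act_gen /=.
    exact: has_valE (has_val_rep _).
  exact: followsE (Pi_extP (has_val_rep _)).
- apply: Pi_ext_eq (followsEs i (Pi_extP (has_val_rep _))).
  rewrite /star op_module_ract op_act_gen /=.
  exact: has_valEs (has_val_rep _).
- rewrite (ractD x) extD (ractD (Pi_ext x));
  exact: (f_equal2 +%R (IHa x) (IHb x)).
- by rewrite !ractM IHb IHa.
Qed.
HB.instance Definition _ := GRing.isLinear.Build (L k n)^c (Pi_obj U) W *:%R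
  Pi_ext Pi_ext_is_linear.

Lemma Pi_ext_inj : injective theta -> injective Pi_ext.
Proof.
move=> inj x y exy; have gx := has_val_rep (x : Pi_space U).
apply: (has_val_eq gx); apply: has_val_ext (has_val_rep _) _.
have := Pi_extP (has_val_rep (y : Pi_space U)); rewrite -exy => ey.
have [N H] := eventually_eq_trans (eventually_eq_sym ey) (Pi_extP gx).
by exists N => w /H /inj.
Qed.

Lemma Pi_ext_surj :
  (forall y : resW, eventually_in (fun z => exists u, theta u = z) y) ->
  forall y : W, exists x, Pi_ext x = y.
Proof.
move=> dense y; have [N H] := dense (y : resW).
have /choice[g gP] : forall w, exists u, (N <= size w)%N ->
    theta u = path_act (y : resW) (FMonom w).
  move=> w; case: (leqP N (size w)) => [/H[u <-]|_]; first by exists u.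
  (* A placeholder: the leaves of the full tree used below are all words of length [N]. *)
  by exists 0.
exists (cls (dfull N g)); apply: Pi_ext_eq (has_val_cls _) _.
(* The value at [w] comes from its prefix of length [N] by the action of [A], which [theta]
   respects. *)
exists N => w le; rewrite val_at_full // linear_path_act gP ?size_takel //.
by rewrite -path_act_cat cat_take_drop.
Qed.

End Extension.

(** * Unit, counit and the equivalence *)

Section Equivalence.
Variables (k : fieldType) (n : nat).

Lemma Pi_ext_natural (U U' : lmodType (A k n)^c) (W W' : lmodType (L k n)^c)
    (theta : {linear U -> (Lambda k n W : lmodType (A k n)^c)})
    (theta' : {linear U' -> (Lambda k n W' : lmodType (A k n)^c)})
    (g : {linear U -> U'}) (f : {linear W -> W'}) :
  (forall u, f (theta u) = theta' (g u)) ->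
  forall x, Pi_ext theta' (Pi_hom g x) = f (Pi_ext theta x).
Proof.
move=> fg x.
apply: (Pi_ext_eq (has_val_Pi_fun g (has_val_rep (x : Pi_space U)))).
have [N H] := Pi_extP theta (has_val_rep (x : Pi_space U)).
exists N => w le; rewrite -fg -H //.
exact: esym (linear_path_act
  (fmor (Lambda k n) (f : hom (c := Rep (L k n)) W W') : {linear _ -> _}) _ _).
Qed.

(** If [[I,u] = [I,v]] then [u.w = v.w] for long [w], and long words separate the vectors of an
    [L]-module. *)
Lemma nondegenerate_sub (U : lmodType (A k n)^c) (W : lmodType (L k n)^c)
    (theta : {linear U -> (Lambda k n W : lmodType (A k n)^c)}) :
  injective theta -> nondegenerate U.
Proof.
move=> inj u v /cls_evP[N H]; apply: inj; apply: eventually_eq_path_act.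
by exists N => w /H e; rewrite -!linear_path_act; congr (theta _).
Qed.

Definition can_mor (V : lmodType (A k n)^c) :
    {linear V -> (Lambda k n (Pi_obj V) : lmodType (A k n)^c)} :=
  @can_map k n V.

Lemma can_map_smallest_complete (V : lmodType (A k n)^c) (S : submodClosed V) :
  smallest_complete S -> smallest_complete (image_pred (can_mor V) S).
Proof.
move=> [cS minS]; split; first exact: image_complete (@can_map_dense _ _ _) cS.
move=> T cT _ /image_predP[v vS <-].
exact: minS _ (preim_complete (can_mor V) cT) v vS.
Qed.

Lemma class_S_Lambda (W : Rep_S_L k n) : class_S (Lambda_restr k n W).
Proof.
case: W => W [V [S smS] WV]; move: WV => /= ->.
exact: ex_intro (can_map_smallest_complete smS).
Qed.

Lemma full_nd_in_Rep_S_L (V : Rep_full_nd k n) : in_Rep_S_L (Pi_restr k n V).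
Proof. by case: V => V [fV ndV]; exists V => //; apply: full_class_S. Qed.

Definition Lambda_S : functor (Rep_S_L k n) (Rep_S k n) :=
  corestrict class_S_Lambda.

Lemma full_nd_Sigma (W : Rep_S_L k n) :
  full_nd (comp_functor (Sigma k n) Lambda_S W).
Proof.
split; first exact: smallest_complete_full (coreP _).
apply: (@nondegenerate_sub _ (sval W) (val : {linear _ -> _})); exact: val_inj.
Qed.

Definition Pi_full_nd : functor (Rep_full_nd k n) (Rep_S_L k n) :=
  corestrict full_nd_in_Rep_S_L.

Definition Sigma_Lambda_S : functor (Rep_S_L k n) (Rep_full_nd k n) :=
  corestrict full_nd_Sigma.

Section Unit.
Variable V : Rep_full_nd k n.
Let V0 : lmodType (A k n)^c := sval V.
(* core depends on the proof of membership in class_S; Sigma uses this one. *)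
Let coreV := core (svalP (Lambda_S (Pi_full_nd V))).

Fact can_map_in_core (v : V0) : can_mor V0 v \in coreV.
Proof.
(* The preimage of the core is complete, hence everything by fullness of [V]. *)
exact: ((svalP V).1 (preim_pred (can_mor V0) coreV)
  (preim_complete (can_mor V0) (coreP _).1) v).
Qed.

Definition unit_fun (v : V0) : submod coreV := Submod (can_map_in_core v).

Fact unit_fun_is_linear : linear unit_fun.
Proof. by move=> a u v; apply: val_inj; rewrite /= linearP. Qed.
HB.instance Definition _ := GRing.isLinear.Build (A k n)^c V0 (submod coreV)
  *:%R unit_fun unit_fun_is_linear.

(** The image of all of [V] is complete, so it contains the core by minimality. *)
Lemma unit_fun_surj (y : submod coreV) : exists v, unit_fun v = y.
Proof.
have := (coreP (svalP (Lambda_S (Pi_full_nd V)))).2 _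
  (image_complete (@can_map_dense _ _ V0) (@setT_complete _ _ V0)) _ (valP y).
by move=> /image_predP[v _ e]; exists v; apply: val_inj.
Qed.

End Unit.

Lemma id_iso_Sigma_Lambda_Pi :
  naturally_isomorphic (id_functor (Rep_full_nd k n))
    (comp_functor Sigma_Lambda_S Pi_full_nd).
Proof.
exists (fun V => unit_fun (V := V) : {linear _ -> _}); split.
- move=> V V' f; apply: linear_ext => v; apply: val_inj => /=.
  exact: esym (Pi_fun_cls _ _).
(* Isomorphisms in a full subcategory are those of the ambient category; injectivity is
   nondegeneracy. *)
- move=> V; apply: (bijective_is_iso (R := A k n)).
    by move=> u v /(congr1 val) e; apply: (svalP V).2.
  exact: unit_fun_surj.
Qed.

Section Counit.
Variable W : Rep_S_L k n.
Let W0 : lmodType (L k n)^c := sval W.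
Let coreW := core (svalP (Lambda_S W)).

Definition core_incl :
    {linear submod coreW -> (Lambda k n W0 : lmodType (A k n)^c)} :=
  val : {linear _ -> _}.

Lemma core_incl_dense (y : Lambda k n W0) :
  eventually_in (fun z => exists u, core_incl u = z) y.
Proof.
have [N H] := (completeP coreW).1 (coreP (svalP (Lambda_S W))).1 y.
by exists N => w le; exists (Submod (H w le)).
Qed.

End Counit.

Lemma Pi_Sigma_Lambda_iso_id :
  naturally_isomorphic (comp_functor Pi_full_nd Sigma_Lambda_S)
    (id_functor (Rep_S_L k n)).
Proof.
exists (fun W => Pi_ext (core_incl W) : {linear _ -> _}); split.
- move=> W W' f; apply: linear_ext => x.
  (* The inclusions commute with [f] by computation, [Sigma] acting by restriction. *)
  exact: (Pi_ext_natural (theta := core_incl W) (theta' := core_incl W')).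
- move=> W; apply: (bijective_is_iso (R := L k n)).
    apply: Pi_ext_inj; exact: val_inj.
  exact: Pi_ext_surj (@core_incl_dense W).
Qed.

End Equivalence.

(* The existentially quantified facts HPi, HLambda and HSigma say that the
   restricted functors land in the stated full subcategories. *)
Theorem theoremA (k : fieldType) (n : nat) (hn : (2 <= n)%N) :
  exists (HPi : forall V : Rep_full_nd k n, in_Rep_S_L (Pi_restr k n V))
         (HLambda : forall W : Rep_S_L k n, class_S (Lambda_restr k n W)),
  let Lambda_S : functor (Rep_S_L k n) (Rep_S k n) := corestrict HLambda in
  exists HSigma : forall W : Rep_S_L k n,
           full_nd (comp_functor (Sigma k n) Lambda_S W),
  let Pi_full_nd : functor (Rep_full_nd k n) (Rep_S_L k n) :=
    corestrict HPi in
  let Sigma_Lambda_S : functor (Rep_S_L k n) (Rep_full_nd k n) :=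
    corestrict HSigma in
  quasi_inverse Pi_full_nd Sigma_Lambda_S.
Proof.
exists (@full_nd_in_Rep_S_L k n), (@class_S_Lambda k n), (@full_nd_Sigma k n).
split; last exact: Pi_Sigma_Lambda_iso_id.
(* The isomorphism given by [j_V] starts at the identity functor, opposite to the direction in
   [quasi_inverse]. *)
exact: naturally_isomorphic_sym (id_iso_Sigma_Lambda_Pi k n).
Qed.
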